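(* Let $f(x,z)\in\mathcal{R}_*(x,z)$. Then for every $n\ge1$ and every $A\in\mathrm{Sei}(n)$, $\chi_f(A)\in\mathcal{R}(x_1,\dots,x_n)$.
   Context: $M'$ denotes the transpose of a matrix $M$. $\mathbb{Q}\langle\langle a_1,\dots,a_n\rangle\rangle$ is the ring of power series in noncommuting variables. Rational functions. $\mathcal{R}(a_1,\dots,a_n)\subset\mathbb{Q}\langle\langle a_1,\dots,a_n\rangle\rangle$ is the smallest subring containing the (noncommutative) polynomials in $a_1,\dots,a_n$ with rational coefficients and closed under taking inverses of special series, i.e. of its elements $f$ with constant term $f(0,\dots,0)=1$. A power series $f\in\mathbb{Q}\langle\langle x,z\rangle\rangle$ is admissible if for every non-negative integer $m$ it has only finitely many terms of total $x$-degree $m$. It is extra-special if it is admissible and $f(0,z)=1$. $\mathcal{R}_*(x,z)$ is the smallest subring of $\mathcal{R}(x,z)$ containing the (noncommutative) polynomials in $x,z$ and closed under taking inverses of extra-special series (i.e. of its elements that are extra-special). All elements of $\mathcal{R}_*(x,z)$ are admissible. Seifert matrices. $\mathrm{Sei}(n)$ is the set of square integer matrices $A=(A_{ij})_{1\le i,j\le n}$ partitioned into $n\times n$ blocks (with square diagonal blocks, of arbitrary sizes) such that $A_{ij}'=A_{ji}$ for $i\neq j$ and $\det(A_{ii}-A_{ii}')=1$ for all $i$. Thus $A-A'$ is block diagonal and invertible over $\mathbb{Z}$, and each diagonal block has even size. Put $Z_A=A(A-A')^{-1}$. Invariants. For $A\in\mathrm{Sei}(n)$ let $X=\mathrm{diag}(x_1,\dots,x_n)$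 be the block diagonal matrix, with the same block sizes as $A$, whose $i$-th diagonal block is $x_i$ times the identity, and let $I_{1/2}$ be a diagonal matrix of the same size in which, in each diagonal block, half of the diagonal entries are $0$ and half are $1$. For admissible $f$, $$\chi_f(A)=\mathrm{tr}\big(f(X,Z_A)-f(X,I_{1/2})\big)\in\mathbb{Q}\langle\langle x_1,\dots,x_n\rangle\rangle$$ (independent of how the $0$'s and $1$'s are distributed in $I_{1/2}$). *)

(* Defs.v *)
From HB Require Import structures.
From mathcomp Require Import all_boot all_order all_algebra.
From mathcomp Require Import boolp classical_sets functions cardinality fsbigop.

Set Implicit Arguments.
Unset Strict Implicit.
Unset Printing Implicit Defensive.

Import Order.TTheory GRing.Theory Num.Theory.
Local Open Scope ring_scope.

(* Power series with rational coefficients in noncommuting variables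
   a_0, ..., a_(n-1): a coefficient for every word.  The record keeps the
   Cauchy product below apart from the pointwise ring structure that
   mathcomp-classical puts on functions. *)
Record ncseries (n : nat) := NCSeries { nccoef :> seq 'I_n -> rat }.

Section NCSeriesRing.
Variable n : nat.
Implicit Types (f g h : ncseries n) (w : seq 'I_n).

Lemma ncseriesP f g : (forall w, f w = g w) -> f = g.
Proof. by case: f g => [f] [g] /= fg; congr NCSeries; apply/funext. Qed.

HB.instance Definition _ := gen_eqMixin (ncseries n).
HB.instance Definition _ := gen_choiceMixin (ncseries n).

Definition nczero := NCSeries (fun _ : seq 'I_n => 0).
Definition ncopp f := NCSeries (fun w => - f w).
Definition ncadd f g := NCSeries (fun w => f w + g w).
Definition ncone := NCSeries (fun w : seq 'I_n => (w == [::])%:R).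
Definition ncmul f g :=
  NCSeries (fun w => \sum_(i < (size w).+1) f (take i w) * g (drop i w)).

Fact ncaddA : associative ncadd.
Proof. by move=> f g h; apply: ncseriesP => w /=; rewrite addrA. Qed.
Fact ncaddC : commutative ncadd.
Proof. by move=> f g; apply: ncseriesP => w /=; rewrite addrC. Qed.
Fact ncadd0 : left_id nczero ncadd.
Proof. by move=> f; apply: ncseriesP => w /=; rewrite add0r. Qed.
Fact ncaddN : left_inverse nczero ncopp ncadd.
Proof. by move=> f; apply: ncseriesP => w /=; rewrite addNr. Qed.

HB.instance Definition _ :=
  GRing.isZmodule.Build (ncseries n) ncaddA ncaddC ncadd0 ncaddN.

Let shift f a := NCSeries (fun w => f (a :: w)).

Let ncmul_nil f g : ncmul f g [::] = f [::] * g [::].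
Proof. by rewrite /= big_ord1. Qed.

Let ncmul_cons f g a w :
  ncmul f g (a :: w) = f [::] * g (a :: w) + ncmul (shift f a) g w.
Proof. by rewrite /= big_ord_recl. Qed.

Fact ncmulDl : left_distributive ncmul ncadd.
Proof.
move=> f g h; apply: ncseriesP => w /=; rewrite -big_split /=.
by apply: eq_bigr => i _; rewrite mulrDl.
Qed.

Fact ncmulDr : right_distributive ncmul ncadd.
Proof.
move=> f g h; apply: ncseriesP => w /=; rewrite -big_split /=.
by apply: eq_bigr => i _; rewrite mulrDr.
Qed.

Let ncmulZ c f g w :
  ncmul (NCSeries (fun v => c * f v)) g w = c * ncmul f g w.
Proof. by rewrite /= mulr_sumr; apply: eq_bigr => i _; rewrite mulrA. Qed.

Fact ncmulA : associative ncmul.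
Proof.
move=> f g h; apply: ncseriesP => w.
elim: w f g h => [|a w IHw] f g h; first by rewrite !ncmul_nil mulrA.
have shiftM : shift (ncmul f g) a =
    ncadd (NCSeries (fun v => f [::] * shift g a v)) (ncmul (shift f a) g).
  by apply: ncseriesP => v; rewrite [LHS]ncmul_cons.
rewrite !ncmul_cons ncmul_nil shiftM ncmulDl.
have ncaddE u v : ncadd u v w = u w + v w by [].
by rewrite ncaddE ncmulZ -IHw mulrDr mulrA addrA.
Qed.

Fact ncmul1l : left_id ncone ncmul.
Proof.
move=> f; apply: ncseriesP => -[|a w]; first by rewrite ncmul_nil mul1r.
rewrite ncmul_cons mul1r [ncmul _ _ _]/= big1 ?addr0 // => i _.
by rewrite mul0r.
Qed.

Fact ncmul1r : right_id ncone ncmul.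
Proof.
move=> f; apply: ncseriesP => w; elim: w f => [|a w IHw] f.
  by rewrite ncmul_nil mulr1.
by rewrite ncmul_cons IHw mulr0 add0r.
Qed.

Fact ncone_neq0 : ncone != 0.
Proof. by apply/eqP => /(congr1 (fun f : ncseries n => f [::])). Qed.

HB.instance Definition _ := GRing.Zmodule_isNzRing.Build (ncseries n)
  ncmulA ncmul1l ncmul1r ncmulDl ncmulDr ncone_neq0.

End NCSeriesRing.

Definition ncvar (n : nat) (i : 'I_n) : ncseries n :=
  NCSeries (fun w => (w == [:: i])%:R).

Definition ncpolynomial (n : nat) (f : ncseries n) : Prop :=
  finite_set [set w | f w != 0]%classic.

(* The smallest subring containing the polynomials and closed under taking
   inverses of those of its elements that satisfy S. *)
Inductive inv_closure (n : nat) (S : ncseries n -> Prop) : ncseries n -> Prop :=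
| inv_closure_poly f : ncpolynomial f -> inv_closure S f
| inv_closure_sub f g :
    inv_closure S f -> inv_closure S g -> inv_closure S (f - g)
| inv_closure_mul f g :
    inv_closure S f -> inv_closure S g -> inv_closure S (f * g)
| inv_closure_inv f g : inv_closure S f -> S f ->
    f * g = 1 -> g * f = 1 -> inv_closure S g.

Definition special (n : nat) (f : ncseries n) : Prop := f [::] = 1.

Definition rational (n : nat) : ncseries n -> Prop := inv_closure (@special n).

(* Series in x, z are series over the alphabet 'I_2. *)
Definition letter_x : 'I_2 := ord0.
Definition letter_z : 'I_2 := ord_max.

Definition xdegree (w : seq 'I_2) : nat := count_mem letter_x w.

Definition admissible (f : ncseries 2) : Prop :=
  forall m : nat, finite_set [set w | f w != 0 /\ xdegree w = m]%classic.

(* f(0, z) *)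
Definition at_x0 (f : ncseries 2) : ncseries 2 :=
  NCSeries (fun w => if xdegree w == 0%N then f w else 0).

Definition extra_special (f : ncseries 2) : Prop :=
  admissible f /\ at_x0 f = 1.

Definition rational_star : ncseries 2 -> Prop := inv_closure extra_special.

(* f(X, Z): sum over all words w of f_w w(X, Z), computed coefficient by
   coefficient.  \sum_(w \in _) is the sum of a finitely supported family (and
   0 if the support is infinite); when the entries of X have no constant term,
   those of Z are constants, and f is admissible, the support is finite. *)
Definition nceval (f : ncseries 2) (n N : nat) (X Z : 'M[ncseries n]_N) :
    'M[ncseries n]_N :=
  \matrix_(p, q) NCSeries (fun u =>
    \sum_(w \in [set: seq 'I_2]%classic)
      f w * (\prod_(l <- w) (if l == letter_x then X else Z)) p q u).

(* A is partitioned into n x n blocks, the (i, j) block being d i x d j. *)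
Definition seifert (n : nat) (d : 'I_n -> nat) (A : 'M[int]_(\sum_i d i)) :
    Prop :=
  (forall i j, i != j -> (submxblock A i j)^T = submxblock A j i) /\
  (forall i, \det (submxblock A i i - (submxblock A i i)^T) = 1).

Definition seifert_Z (N : nat) (A : 'M[int]_N) : 'M[int]_N :=
  A *m invmx (A - A^T).

Definition diag_x (n : nat) (d : 'I_n -> nat) :
    'M[ncseries n]_(\sum_i d i) :=
  \mxdiag_(i < n) (ncvar i)%:M.

(* The diagonal 0-1 matrix whose ones in the i-th diagonal block are at the
   positions in e i; it is an I_{1/2} when each e i has d i / 2 elements. *)
Definition diag_01 (n : nat) (d : 'I_n -> nat) (e : forall i, {set 'I_(d i)}) :
    'M[int]_(\sum_i d i) :=
  \mxdiag_(i < n) diag_mx (\row_p (p \in e i)%:R).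

Definition half_sets (n : nat) (d : 'I_n -> nat)
    (e : forall i, {set 'I_(d i)}) : Prop :=
  forall i, #|e i|.*2 = d i.

(* chi_f(A), with I_{1/2} given by e. *)
Definition chi (f : ncseries 2) (n : nat) (d : 'I_n -> nat)
    (A : 'M[int]_(\sum_i d i)) (e : forall i, {set 'I_(d i)}) : ncseries n :=
  \tr (nceval f (diag_x d) (map_mx intr (seifert_Z A))
       - nceval f (diag_x d) (map_mx intr (diag_01 e))).

(* The diagonal blocks of a Seifert matrix have even size, so that an I_{1/2}
   always exists. *)
Lemma seifert_half_sets (n : nat) (d : 'I_n -> nat)
    (A : 'M[int]_(\sum_i d i)) :
  seifert A -> exists e : forall i, {set 'I_(d i)}, half_sets e.
Proof.
move=> [_ detA]; exists (fun i => [set p : 'I_(d i) | (p < (d i)./2)%N]) => i.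
have evd : odd (d i) = false.
  apply/negP => oddd; set B := submxblock A i i - (submxblock A i i)^T.
  have BT : B^T = - B by rewrite /B linearB /= trmxK opprB.
  have := det_tr B; rewrite BT -scaleN1r detZ detA -signr_odd oddd.
  by [].
have led : ((d i)./2 <= d i)%N.
  by rewrite leq_half_double -addnn leqW // leq_addr.
rewrite cardsE -sum1_card (big_ord_narrow led) sum1_card card_ord.
by rewrite even_halfK // evd.
Qed.

(* Main.v *)
Require Import Defs.
From mathcomp Require Import all_boot all_order all_algebra.
From mathcomp Require Import boolp classical_sets cardinality fsbigop.

(** For matrices [X] and [Z] over the series ring whose entries are
    homogeneous of degree 1 and 0 respectively, a word [w] evaluates to a matrix
    that is homogeneous of degree [xdegree w].  So each coefficient of [f(X, Z)]
    involves only the words of one [x]-degree, of which an admissible [f]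
    contains finitely many, and evaluation at [(X, Z)] is a ring morphism on
    admissible series ([ncevalB], [ncevalM], [nceval1]).

    It follows by induction over the construction of [f] that [f(X, Z)] has
    rational entries ([rational_star_eval]).  Only inverses need an argument.
    If [f] is extra-special, the part of [f(X, Z)] of degree zero is
    [f(0, Z) = 1], so [f(X, Z)] is the identity matrix modulo series without
    constant term.  Gaussian elimination inverts such a matrix while dividing
    only by special series, hence within rational matrices
    ([special_mx_rinv]).  Since evaluation is multiplicative, the inverse of
    [f(X, Z)] is the value at [(X, Z)] of the inverse of [f].  This last step
    uses that the inverse of an extra-special series is admissible
    ([extra_special_inv_admissible]).

    Both [Z_A] and [I_{1/2}] have integer entries, so both terms of [chi] are
    traces of rational matrices. *)

Set Implicit Arguments.
Unset Strict Implicit.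
Unset Printing Implicit Defensive.

Import GRing.Theory.
Local Open Scope ring_scope.

(** * Coefficients and inverses of special series *)

Section Coefficients.
Variable n : nat.
Implicit Types (f g h : ncseries n) (w : seq 'I_n).

Lemma nccoefN f w : (- f) w = - f w. Proof. by []. Qed.
Lemma nccoefD f g w : (f + g) w = f w + g w. Proof. by []. Qed.
Lemma nccoefB f g w : (f - g) w = f w - g w. Proof. by []. Qed.
Lemma nccoef1 w : (1 : ncseries n) w = (w == [::])%:R. Proof. by []. Qed.
Lemma nccoefM f g w :
  (f * g) w = \sum_(i < (size w).+1) f (take i w) * g (drop i w).
Proof. by []. Qed.

Lemma nccoef_sum (I : Type) (r : seq I) (P : pred I) (F : I -> ncseries n) w :
  (\sum_(i <- r | P i) F i) w = \sum_(i <- r | P i) F i w.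
Proof. exact: (big_morph (fun f : ncseries n => f w)). Qed.

Lemma nccoefM0 f g : (f * g) [::] = f [::] * g [::].
Proof. by rewrite nccoefM big_ord1. Qed.

(** Allows the right factor to be replaced by a truncation that depends on the
    coefficient under consideration. *)
Lemma nccoefM_local f g g' w :
  (forall v, (size v <= size w)%N -> g v = g' v) -> (f * g) w = (f * g') w.
Proof.
move=> gg'; rewrite !nccoefM; apply: eq_bigr => i _.
by rewrite gg' // size_drop leq_subr.
Qed.

Lemma nccoefX_eq0 h k w : h [::] = 0 -> (size w < k)%N -> (h ^+ k) w = 0.
Proof.
move=> h0; elim: k w => // k IHk w; rewrite ltnS => wk.
rewrite exprS nccoefM big1 // => i _.
case: (posnP i) => [->|i_gt0]; first by rewrite take0 h0 mul0r.
rewrite IHk ?mulr0 // size_drop; apply: leq_trans wk.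
have := ltn_ord i; rewrite ltnS => iw.
by rewrite ltn_subrL i_gt0 (leq_trans i_gt0 iw).
Qed.

(** Geometric series: with [h = 1 - f], the inverse is the sum of the [h ^+ k],
    and the terms [k > size w] do not contribute to the coefficient of [w]. *)
Lemma special_rinv f : special f -> exists2 g, special g & f * g = 1.
Proof.
move=> f1; pose h := 1 - f.
have h0 : h [::] = 0 by rewrite nccoefB f1 subrr.
pose s k := \sum_(i < k) h ^+ i.
have fs k : f * s k = 1 - h ^+ k.
  by rewrite -[RHS]opprB subrX1 -mulNr opprB /h opprB addrC subrK.
(* Summing up to [size w] makes [g] agree with a partial sum [s k] on all words
   shorter than [k]. *)
pose g := NCSeries (fun w => s (size w).+1 w).
have gs w v : (size v <= size w)%N -> g v = s (size w).+1 v.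
  move=> vw; rewrite /g /= /s !nccoef_sum.
  rewrite (big_ord_widen (size w).+1 (fun i : nat => (h ^+ i) v)) //.
  rewrite big_mkcond; apply: eq_bigr => i _; case: ltnP => // vi.
  by rewrite nccoefX_eq0.
exists g; first by rewrite /special /g /= /s big_ord1 expr0.
apply: ncseriesP => w; rewrite (nccoefM_local f (gs w)) fs nccoefB.
by rewrite nccoefX_eq0 ?subr0.
Qed.

(** The right inverse is itself special, hence has a right inverse too, which
    forces it to be two-sided. *)
Lemma special_inv f : special f -> exists g, f * g = 1 /\ g * f = 1.
Proof.
move=> /special_rinv[g /special_rinv[f' _ gf'] fg]; exists g; split=> //.
by rewrite -[RHS]gf' -[in RHS](mul1r f') -[in RHS]fg -!mulrA gf' mulr1.
Qed.

End Coefficients.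

(** * Homogeneous series *)

Section Homogeneous.
Variable n : nat.
Implicit Types (f g : ncseries n).

Definition homog (k : nat) f := forall u, f u != 0 -> size u = k.

Lemma ncpolynomial_seq f (s : seq (seq 'I_n)) :
  (forall w, f w != 0 -> w \in s) -> ncpolynomial f.
Proof. by move=> fs; apply: sub_finite_set (finite_seq s) => w; apply: fs. Qed.

(** The alphabet is finite, so there are finitely many words of each length. *)
Lemma homog_ncpolynomial k f : homog k f -> ncpolynomial f.
Proof.
move=> hf; apply: (ncpolynomial_seq (s := map val (enum {: k.-tuple 'I_n}))).
move=> w /hf /eqP wk; apply/mapP; exists (Tuple wk) => //.
by rewrite mem_enum.
Qed.

Lemma homog0 k : homog k 0. Proof. by move=> u; rewrite eqxx. Qed.

Lemma homog1 : homog 0 1.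
Proof. by move=> u; rewrite nccoef1; case: u => //=; rewrite eqxx. Qed.

Lemma homog_var i : homog 1 (@ncvar n i).
Proof.
by move=> u /=; case: (eqVneq u [:: i]) => [-> //|_]; rewrite eqxx.
Qed.

Lemma homogN k f : homog k f -> homog k (- f).
Proof. by move=> hf u; rewrite nccoefN oppr_eq0; apply: hf. Qed.

Lemma homogD k f g : homog k f -> homog k g -> homog k (f + g).
Proof.
move=> hf hg u; case: (eqVneq (f u) 0) => [f0|/hf //].
by rewrite nccoefD f0 add0r; apply: hg.
Qed.

Lemma homogMn k f m : homog k f -> homog k (f *+ m).
Proof.
move=> hf; elim: m => [|m IHm]; first exact: homog0.
by rewrite mulrS; apply: homogD.
Qed.

Lemma homog_intr (m : int) : homog 0 (m%:~R : ncseries n).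
Proof.
case: m => m; last apply: homogN; apply: homogMn; exact: homog1.
Qed.

Lemma homogM k l f g : homog k f -> homog l g -> homog (k + l) (f * g).
Proof.
move=> hf hg u; apply: contraNeq => ukl; rewrite nccoefM big1 // => i _.
case: (eqVneq (f (take i u)) 0) => [->|/hf fk]; first by rewrite mul0r.
case: (eqVneq (g (drop i u)) 0) => [->|/hg gl]; first by rewrite mulr0.
by rewrite -(cat_take_drop i u) size_cat fk gl eqxx in ukl.
Qed.

Lemma homog_sum (I : Type) (r : seq I) (P : pred I) (F : I -> ncseries n) k :
  (forall i, P i -> homog k (F i)) -> homog k (\sum_(i <- r | P i) F i).
Proof. by move=> hF; apply: big_ind hF; [apply: homog0|apply: homogD]. Qed.

End Homogeneous.

(** * Rational matrices *)

Section Closure.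
Variables (n : nat) (S : ncseries n -> Prop).
Let C := inv_closure S.

Lemma inv_closure_homog k f : homog k f -> C f.
Proof. by move=> /homog_ncpolynomial; apply: inv_closure_poly. Qed.

Lemma inv_closure0 : C 0.
Proof. exact: inv_closure_homog (@homog0 _ 0). Qed.

Lemma inv_closure_opp f : C f -> C (- f).
Proof. by rewrite -sub0r; apply: inv_closure_sub; apply: inv_closure0. Qed.

Lemma inv_closure_add f g : C f -> C g -> C (f + g).
Proof.
by move=> Cf Cg; rewrite -[g]opprK; apply/inv_closure_sub/inv_closure_opp.
Qed.

Lemma inv_closure_sum (I : Type) (r : seq I) (P : pred I)
    (F : I -> ncseries n) :
  (forall i, P i -> C (F i)) -> C (\sum_(i <- r | P i) F i).
Proof.
by move=> CF; apply: big_ind CF; [apply: inv_closure0|apply: inv_closure_add].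
Qed.

End Closure.

Section RationalMatrices.
Variable n : nat.

Definition rational_mx (p q : nat) (M : 'M[ncseries n]_(p, q)) : Prop :=
  forall i j, rational (M i j).

Lemma rational_mxN p q (M : 'M_(p, q)) : rational_mx M -> rational_mx (- M).
Proof. by move=> rM i j; rewrite mxE; exact: inv_closure_opp (rM i j). Qed.

Lemma rational_mxD p q (M M' : 'M_(p, q)) :
  rational_mx M -> rational_mx M' -> rational_mx (M + M').
Proof.
move=> rM rM' i j; rewrite mxE.
exact: inv_closure_add (rM i j) (rM' i j).
Qed.

Lemma rational_mxB p q (M M' : 'M_(p, q)) :
  rational_mx M -> rational_mx M' -> rational_mx (M - M').
Proof. by move=> rM rM'; apply/rational_mxD/rational_mxN. Qed.

Lemma rational_mxM p q r (M : 'M_(p, q)) (M' : 'M_(q, r)) :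
  rational_mx M -> rational_mx M' -> rational_mx (M *m M').
Proof.
move=> rM rM' i j; rewrite mxE; apply: inv_closure_sum => k _.
exact: inv_closure_mul (rM i k) (rM' k j).
Qed.

Lemma rational_mx_tr p (M : 'M_p) : rational_mx M -> rational (\tr M).
Proof. by move=> rM; apply: inv_closure_sum => i _; apply: rM. Qed.

Lemma rational_mx_block p1 p2 q1 q2 (A : 'M_(p1, q1)) (B : 'M_(p1, q2))
    (C : 'M_(p2, q1)) (D : 'M_(p2, q2)) :
  rational_mx A -> rational_mx B -> rational_mx C -> rational_mx D ->
  rational_mx (block_mx A B C D).
Proof.
move=> rA rB rC rD i j.
by case: (split_ordP i) => k ->; case: (split_ordP j) => l ->;
  rewrite ?(block_mxEul, block_mxEur, block_mxEdl, block_mxEdr).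
Qed.

Definition special_mx (N : nat) (M : 'M[ncseries n]_N) : Prop :=
  forall i j, M i j [::] = (i == j)%:R.

Lemma mulmx_ct0 p q r (M : 'M[ncseries n]_(p, q)) (M' : 'M_(q, r)) :
  (forall i j, M i j [::] = 0) -> forall i j, (M *m M') i j [::] = 0.
Proof.
move=> M0 i j; rewrite mxE nccoef_sum big1 // => k _.
by rewrite nccoefM0 M0 mul0r.
Qed.

(** Gaussian elimination: the pivot is a special rational series, and the Schur
    complement of the pivot is again the identity up to series without constant
    term.  A one-sided inverse is enough, as a left inverse is known whenever
    this is used. *)
Lemma special_mx_rinv N (F : 'M[ncseries n]_N) :
  special_mx F -> rational_mx F -> exists2 G, rational_mx G & F *m G = 1%:M.
Proof.
elim: N F => [|N IHN] F sF rF.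
  by exists 0; [case|apply/matrixP; case].
pose F' : 'M_(1 + N) := F; have sF' : special_mx F' := sF.
have [g [ag ga]] : exists g, F' 0 0 * g = 1 /\ g * F' 0 0 = 1.
  by apply: special_inv; rewrite /special sF.
have rg : rational g.
  by apply: inv_closure_inv ag ga; [apply: rF|rewrite /special sF].
set a := ulsubmx F'; set b := ursubmx F'; set c := dlsubmx F'.
set D := drsubmx F'; pose ai : 'M_1 := g%:M.
have aai : a *m ai = 1%:M.
  have l0 : lshift N (0 : 'I_1) = 0 by apply: val_inj.
  by apply/matrixP => i j; rewrite !ord1 !mxE big_ord1 !mxE l0 ag.
have rai : rational_mx ai by move=> i j; rewrite !ord1 mxE.
have rb : rational_mx b by move=> i j; rewrite !mxE; apply: rF.
have rc : rational_mx c by move=> i j; rewrite !mxE; apply: rF.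
have rD : rational_mx D by move=> i j; rewrite !mxE; apply: rF.
have c0 i j : c i j [::] = 0 by rewrite !mxE sF' eq_rlshift.
have [E rE DE] : exists2 E, rational_mx E & (D - c *m ai *m b) *m E = 1%:M.
  apply: IHN; last by do !apply: rational_mxB || apply: rational_mxM.
  move=> i j; rewrite mxE [in X in _ + X]mxE nccoefB.
  by rewrite -mulmxA (mulmx_ct0 _ c0) subr0 !mxE sF' eq_rshift.
have DEE : D *m E = 1%:M + c *m ai *m b *m E.
  by rewrite -DE mulmxBl subrK.
(* The inverse of a block matrix in terms of the inverse [ai] of its upper left
   block [a] and the inverse [E] of the Schur complement. *)
pose G : 'M_(1 + N) := block_mx (ai + ai *m b *m E *m c *m ai)
  (- (ai *m b *m E)) (- (E *m c *m ai)) E.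
have rG : rational_mx G.
  by apply: rational_mx_block => //;
    do !(apply: rational_mxD || apply: rational_mxN || apply: rational_mxM).
suff FG : F' *m G = 1%:M by exists G.
rewrite -[F']submxK mulmx_block -/a -/b -/c -/D.
have -> : 1%:M = block_mx 1%:M 0 0 1%:M :> 'M[ncseries n]_(1 + N).
  by rewrite scalar_mx_block.
congr block_mx.
- by rewrite mulmxDr mulmxN !mulmxA aai !mul1mx addrK.
- by rewrite mulmxN !mulmxA aai mul1mx addNr.
- rewrite mulmxDr mulmxN !mulmxA DEE.
  by rewrite !mulmxDl mul1mx opprD addrACA subrr add0r subrr.
- by rewrite mulmxN !mulmxA DEE addrC addrK.
Qed.

End RationalMatrices.

(** * Admissible series *)

Section Admissible.
Implicit Types f g h : ncseries 2.

(** Finite lists of words replace finite supports: they allow every infinite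
    sum below to be computed as a sum over a list, uniformly in all the
    coefficients up to a given degree. *)
Definition covers f (m : nat) (s : seq (seq 'I_2)) : Prop :=
  forall w, f w != 0 -> (xdegree w <= m)%N -> w \in s.

Lemma xdegree_cat a b : xdegree (a ++ b) = (xdegree a + xdegree b)%N.
Proof. exact: count_cat. Qed.

Lemma admissible_covers f :
  admissible f -> forall m, exists2 s, uniq s & covers f m s.
Proof.
move=> af m.
suff [s cs] : exists s, covers f m s.
  by exists (undup s) => [|w fw wm]; rewrite ?undup_uniq // mem_undup cs.
elim: m => [|m [s cs]].
  have /finite_seqP[s sE] := af 0%N.
  exists s => w fw; rewrite leqn0 => /eqP w0.
  by have : [set` s]%classic w by rewrite -sE.
have /finite_seqP[t tE] := af m.+1.
exists (s ++ t) => w fw; rewrite mem_cat leq_eqVlt => /orP[/eqP wm|wm].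
  by apply/orP; right; have : [set` t]%classic w by rewrite -tE.
by rewrite cs.
Qed.

Lemma covers_admissible f : (forall m, exists s, covers f m s) -> admissible f.
Proof.
move=> cf m; have [s cs] := cf m.
apply: sub_finite_set (finite_seq s) => w [fw wm].
by apply: cs => //; rewrite wm.
Qed.

Lemma coversM f g m s t : covers f m s -> covers g m t ->
  covers (f * g) m [seq a ++ b | a <- s, b <- t].
Proof.
move=> cs ct w fgw wm.
have [i fgi] : exists i : 'I_(size w).+1, f (take i w) * g (drop i w) != 0.
  apply/existsP; apply: contra_neqT fgw => /existsPn fg0.
  by rewrite nccoefM big1 // => i _; apply/eqP; move: (fg0 i); rewrite negbK.
move: fgi; rewrite mulf_eq0 negb_or => /andP[fi gi].
move: wm; rewrite -(cat_take_drop i w) xdegree_cat => wm.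
apply: allpairs_f.
  by apply: cs => //; apply: leq_trans wm; apply: leq_addr.
by apply: ct => //; apply: leq_trans wm; apply: leq_addl.
Qed.

Lemma admissibleM f g : admissible f -> admissible g -> admissible (f * g).
Proof.
move=> /admissible_covers af /admissible_covers ag.
apply: covers_admissible => m; have [s _ cs] := af m; have [t _ ct] := ag m.
by eexists; apply: coversM cs ct.
Qed.

Lemma admissibleB f g : admissible f -> admissible g -> admissible (f - g).
Proof.
move=> /admissible_covers af /admissible_covers ag.
apply: covers_admissible => m; have [s _ cs] := af m; have [t _ ct] := ag m.
exists (s ++ t) => w fgw wm; rewrite mem_cat.
case: (eqVneq (f w) 0) => [f0|fw]; last by rewrite cs.
rewrite ct ?orbT //; apply: contraNneq fgw => g0.
by rewrite nccoefB f0 g0 subr0.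
Qed.

Lemma ncpolynomial_admissible f : ncpolynomial f -> admissible f.
Proof. by move=> pf m; apply: sub_finite_set pf => w []. Qed.

Lemma extra_special_coef f w :
  extra_special f -> xdegree w = 0%N -> f w = (w == [::])%:R.
Proof.
move=> [_ /(congr1 (fun g : ncseries 2 => g w))] /= + w0.
by rewrite w0 eqxx.
Qed.

(** With [h = 1 - f] one has [g = 1 + h * g], and every word of [h] has positive
    [x]-degree; so the words of [g] of degree at most [m + 1] are obtained from
    those of [g] of degree at most [m] and those of [h]. *)
Lemma extra_special_inv_admissible f g :
  extra_special f -> f * g = 1 -> admissible g.
Proof.
move=> ef fg; apply: covers_admissible.
have ah : admissible (1 - f).
  apply: admissibleB; last by case: ef.
  exact/ncpolynomial_admissible/homog_ncpolynomial/homog1.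
have gE : g = 1 + (1 - f) * g by rewrite mulrBl mul1r fg addrC subrK.
elim => [|m [t ct]].
  exists [:: [::]] => w; rewrite gE => gw; rewrite leqn0 => /eqP w0.
  move: gw; rewrite nccoefD nccoef1 inE; case: (eqVneq w [::]) => // _.
  rewrite add0r nccoefM big1 ?eqxx // => i _.
  move: w0; rewrite -[w in xdegree w](cat_take_drop i w) xdegree_cat.
  move=> /eqP; rewrite addn_eq0 => /andP[/eqP ti _].
  by rewrite nccoefB (extra_special_coef ef ti) nccoef1 subrr mul0r.
have [s _ cs] := admissible_covers ah m.+1.
exists ([::] :: [seq a ++ b | a <- s, b <- t]) => w gw wm.
rewrite inE; case: (eqVneq w [::]) => //= wn0.
have [i hgi] :
    exists i : 'I_(size w).+1, (1 - f) (take i w) * g (drop i w) != 0.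
  apply/existsP; apply: contra_neqT gw => /existsPn hg0.
  rewrite gE nccoefD nccoef1 (negPf wn0) mulr0n add0r nccoefM big1 // => i _.
  by apply/eqP; move: (hg0 i); rewrite negbK.
move: hgi; rewrite mulf_eq0 negb_or => /andP[hi gi].
have ti : (0 < xdegree (take i w))%N.
  rewrite lt0n; apply: contraNneq hi => ti.
  by rewrite nccoefB (extra_special_coef ef ti) nccoef1 subrr.
move: wm; rewrite -(cat_take_drop i w) xdegree_cat => wm.
apply: allpairs_f.
  by apply: cs => //; apply: leq_trans wm; apply: leq_addr.
apply: ct => //; rewrite -ltnS; apply: leq_trans wm.
by rewrite -[X in (X < _)%N]add0n ltn_add2r.
Qed.

Lemma rational_star_admissible f : rational_star f -> admissible f.
Proof.
elim=> {f} [f|f g _ af _ ag|f g _ af _ ag|f g _ _ ef fg _].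
- exact: ncpolynomial_admissible.
- exact: admissibleB.
- exact: admissibleM.
- exact: extra_special_inv_admissible fg.
Qed.

End Admissible.

(** * Evaluation at matrices *)

Section Evaluation.
Variables n N : nat.
Implicit Types (f g : ncseries 2) (X Z : 'M[ncseries n]_N).

Definition homog_mx (k : nat) (p q : nat) (M : 'M[ncseries n]_(p, q)) : Prop :=
  forall i j, homog k (M i j).

Definition word_mx X Z (w : seq 'I_2) : 'M[ncseries n]_N :=
  \prod_(l <- w) (if l == letter_x then X else Z).

Lemma word_mx_cat X Z a b :
  word_mx X Z (a ++ b) = word_mx X Z a *m word_mx X Z b.
Proof. by rewrite /word_mx big_cat. Qed.

Variables X Z : 'M[ncseries n]_N.
Hypotheses (hX : homog_mx 1 X) (hZ : homog_mx 0 Z).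

Lemma word_mx_homog w : homog_mx (xdegree w) (word_mx X Z w).
Proof.
elim: w => [|l w IHw] i j; rewrite /word_mx.
  by rewrite big_nil mxE; apply: homogMn; apply: homog1.
have -> : xdegree (l :: w) = ((l == letter_x) + xdegree w)%N by [].
rewrite big_cons -mulmxE mxE; apply: homog_sum => k _.
apply: homogM (IHw _ _).
by case: (l == letter_x); [apply: hX | apply: hZ].
Qed.

(** The finitely supported sum defining [nceval] may be taken over any list that
    covers [f] up to degree [size u]: the other words of [f] have larger degree,
    and their values are homogeneous of that degree. *)
Lemma nceval_coef f m s p q u : uniq s -> covers f m s -> (size u <= m)%N ->
  nceval f X Z p q u = \sum_(w <- s) f w * word_mx X Z w p q u.
Proof.
move=> us cs um; rewrite mxE /= (fsbigE s) //=.
  by apply: eq_bigl => w; rewrite in_setT.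
move=> w _; apply: contraNeq; rewrite mulf_eq0 negb_or.
move=> /andP[fw /word_mx_homog wu].
by apply: cs; rewrite // -wu.
Qed.

Lemma ncevalB f g : admissible f -> admissible g ->
  nceval (f - g) X Z = nceval f X Z - nceval g X Z.
Proof.
move=> /admissible_covers af /admissible_covers ag.
apply/matrixP => p q; apply: ncseriesP => u.
have [s _ cs] := af (size u); have [t _ ct] := ag (size u).
pose r := undup (s ++ t); have ur : uniq r by apply: undup_uniq.
have cf : covers f (size u) r.
  by move=> w fw wu; rewrite mem_undup mem_cat cs.
have cg : covers g (size u) r.
  by move=> w gw wu; rewrite mem_undup mem_cat ct ?orbT.
have cfg : covers (f - g) (size u) r.
  move=> w fgw wu; case: (eqVneq (f w) 0) => [f0|fw]; last exact: cf.
  by apply: cg => //; apply: contraNneq fgw => g0; rewrite nccoefB f0 g0 subr0.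
rewrite [RHS](_ : _ = nceval f X Z p q u - nceval g X Z p q u); last first.
  by rewrite !mxE.
rewrite (nceval_coef _ _ ur cf (leqnn _)) (nceval_coef _ _ ur cg (leqnn _)).
rewrite (nceval_coef _ _ ur cfg (leqnn _)) -sumrB.
by apply: eq_bigr => w _; rewrite nccoefB mulrBl.
Qed.

Lemma sum_if_eq (T : eqType) (s : seq T) (F : T -> rat) x :
  uniq s -> (F x != 0 -> x \in s) ->
  F x = \sum_(a <- s) if a == x then F a else 0.
Proof.
move=> us Fx; rewrite -big_mkcond -big_filter /=.
case: (boolP (x \in s)) => xs; first by rewrite filter_pred1_uniq ?big_seq1.
rewrite big_filter big1_seq => [|a /andP[/eqP -> ax]].
  by apply/eqP; apply: contraNT xs.
by rewrite ax in xs.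
Qed.

(** Turns the sum over the cuts of [w] into a sum over a set of pairs that is
    the same for all [w], so that it can be exchanged with the sum over [w]. *)
Lemma nccoefM_covers f g m s t w : uniq s -> uniq t ->
  covers f m s -> covers g m t -> (xdegree w <= m)%N ->
  (f * g) w = \sum_(a <- s) \sum_(b <- t) if a ++ b == w then f a * g b else 0.
Proof.
move=> us ut cs ct wm; rewrite nccoefM.
transitivity (\sum_(i < (size w).+1) \sum_(a <- s) \sum_(b <- t)
    if (a == take i w) && (b == drop i w) then f a * g b else 0).
  apply: eq_bigr => i _.
  move: wm; rewrite -{1}(cat_take_drop i w) xdegree_cat => wm.
  rewrite (@sum_if_eq _ s f (take i w)) //; last first.
    by move=> fi; apply: cs => //; apply: leq_trans wm; apply: leq_addr.
  rewrite (@sum_if_eq _ t g (drop i w)) //; last first.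
    by move=> gi; apply: ct => //; apply: leq_trans wm; apply: leq_addl.
  rewrite big_distrlr /=; apply: eq_bigr => a _; apply: eq_bigr => b _.
  by case: eqP; case: eqP; rewrite ?mul0r ?mulr0.
rewrite exchange_big /=; apply: eq_bigr => a _.
rewrite exchange_big /=; apply: eq_bigr => b _.
case: eqVneq => [<-|abw]; last first.
  rewrite big1 // => i _; case: andP => // -[/eqP ai /eqP bi].
  by rewrite ai bi cat_take_drop eqxx in abw.
have asz : (size a < (size (a ++ b)).+1)%N by rewrite ltnS size_cat leq_addr.
rewrite -big_mkcond (big_pred1 (Ordinal asz)) // => i /=.
apply/andP/eqP => [[/eqP ai _]|->]; last first.
  by rewrite take_size_cat ?drop_size_cat.
apply: val_inj; rewrite /= [in RHS]ai size_takel //.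
by have := ltn_ord i; rewrite ltnS.
Qed.

(** The words of [f * g] are concatenations [a ++ b], and evaluation takes these
    to products of matrices; the rest is an exchange of finite sums. *)
Lemma ncevalM f g : admissible f -> admissible g ->
  nceval (f * g) X Z = nceval f X Z *m nceval g X Z.
Proof.
move=> /admissible_covers af /admissible_covers ag.
apply/matrixP => p q; apply: ncseriesP => u; set m := size u.
have [s us cs] := af m; have [t ut ct] := ag m.
pose W := word_mx X Z; pose r := undup [seq a ++ b | a <- s, b <- t].
have ur : uniq r by apply: undup_uniq.
have cfg : covers (f * g) m r.
  by move=> w fgw wm; rewrite mem_undup (coversM cs ct).
transitivity (\sum_(a <- s) \sum_(b <- t) f a * g b * W (a ++ b) p q u).
  rewrite (nceval_coef _ _ ur cfg (leqnn _)).
  under eq_bigr => w _.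
    have -> : (f * g) w * word_mx X Z w p q u = \sum_(a <- s) \sum_(b <- t)
        if a ++ b == w then f a * g b * W (a ++ b) p q u else 0.
      case: (leqP (xdegree w) m) => wm.
        rewrite (nccoefM_covers us ut cs ct wm) mulr_suml.
        apply: eq_bigr => a _; rewrite mulr_suml; apply: eq_bigr => b _.
        by case: eqVneq => [->|]; rewrite ?mul0r.
      (* [W w] lives in degree [xdegree w > size u]. *)
      have W0 : W w p q u = 0.
        by apply: contraTeq wm => /word_mx_homog <-; rewrite ltnn.
      rewrite -/W W0 mulr0 big1 // => a _; rewrite big1 // => b _.
      by case: eqVneq => // ->; rewrite W0 mulr0.
    over.
  rewrite exchange_big /=; apply: eq_big_seq => a sa.
  rewrite exchange_big /=; apply: eq_big_seq => b tb.
  rewrite -big_mkcond /= -big_filter.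
  have abr : a ++ b \in r by rewrite mem_undup allpairs_f.
  under eq_filter => w do rewrite eq_sym.
  by rewrite (filter_pred1_uniq ur abr) big_seq1.
rewrite [in RHS]mxE nccoef_sum.
under [RHS]eq_bigr => k _.
  rewrite nccoefM; under eq_bigr => i _.
    rewrite (nceval_coef (m := m) _ _ us cs) ?size_take_min ?geq_minr //.
    rewrite (nceval_coef (m := m) _ _ ut ct) ?size_drop ?leq_subr //.
    rewrite big_distrlr /=; over.
  rewrite exchange_big /=; under eq_bigr => a _ do rewrite exchange_big /=.
  over.
rewrite [RHS]exchange_big /=; apply: eq_bigr => a _.
rewrite [RHS]exchange_big /=; apply: eq_bigr => b _.
rewrite /W word_mx_cat mxE nccoef_sum mulr_sumr; apply: eq_bigr => k _.
by rewrite nccoefM mulr_sumr; apply: eq_bigr => i _; rewrite mulrACA.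
Qed.

(** The constant term of [f(X, Z)] comes from [f(0, Z)] alone, as the entries of
    [X] have no constant term. *)
Lemma nceval_special f :
  (forall w, xdegree w = 0%N -> f w = (w == [::])%:R) ->
  special_mx (nceval f X Z).
Proof.
move=> f0 p q.
have cf : covers f 0 [:: [::]].
  move=> w + w0; rewrite f0 ?inE; last by apply/eqP; rewrite -leqn0.
  by case: (w == [::]) => //; rewrite eqxx.
rewrite (nceval_coef _ _ _ cf) // big_seq1 f0 // mul1r.
by rewrite /word_mx big_nil mxE; case: (p == q).
Qed.

Lemma nceval1 : nceval 1 X Z = 1%:M.
Proof.
apply/matrixP => p q; apply: ncseriesP => u.
have c1 : covers 1 (size u) [:: [::]].
  move=> w + _; rewrite nccoef1 inE.
  by case: (w == [::]) => //; rewrite eqxx.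
rewrite (nceval_coef _ _ _ c1) // big_seq1 nccoef1 eqxx mul1r.
by rewrite /word_mx big_nil.
Qed.

Lemma ncpolynomial_eval_rational f :
  ncpolynomial f -> rational_mx (nceval f X Z).
Proof.
move=> /finite_seqP[s sE] p q; pose r := undup s.
have -> : nceval f X Z p q =
    \sum_(w <- r) NCSeries (fun u => f w * word_mx X Z w p q u).
  apply: ncseriesP => u; rewrite nccoef_sum.
  apply: (nceval_coef (m := size u)); rewrite ?undup_uniq // => w fw _.
  by rewrite mem_undup; have : [set` s]%classic w by rewrite -sE.
apply: inv_closure_sum => w _; apply: (@inv_closure_homog _ _ (xdegree w)).
by move=> u /=; rewrite mulf_eq0 negb_or => /andP[_ /word_mx_homog].
Qed.

Lemma rational_star_eval f : rational_star f -> rational_mx (nceval f X Z).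
Proof.
elim=> {f} [f|f g sf rf sg rg|f g sf rf sg rg|f g sf rf ef fg gf].
- exact: ncpolynomial_eval_rational.
- have af := rational_star_admissible sf.
  have ag := rational_star_admissible sg.
  by rewrite ncevalB //; apply: rational_mxB.
- have af := rational_star_admissible sf.
  have ag := rational_star_admissible sg.
  by rewrite ncevalM //; apply: rational_mxM.
have af := rational_star_admissible sf.
have ag := extra_special_inv_admissible ef fg.
have sF : special_mx (nceval f X Z).
  by apply: nceval_special => w; apply: extra_special_coef.
(* [g(X, Z)] is a left inverse of [f(X, Z)], hence equals its right inverse. *)
have [G rG FG] := special_mx_rinv sF rf.
suff -> : nceval g X Z = G by [].
by rewrite -[LHS]mulmx1 -FG mulmxA -ncevalM // gf nceval1 mul1mx.
Qed.

End Evaluation.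

(** * Rationality of the invariants *)

Lemma homog_diag_x n (d : 'I_n -> nat) : homog_mx 1 (diag_x d).
Proof.
have hom_block i j : homog_mx 1 (if i == j
    then conform_mx 0 ((ncvar i)%:M : 'M_(d i)) else 0
      : 'M[ncseries n]_(d i, d j)).
  (* The block sizes depend on [i] and [j], so [l] is generalized before they are
     identified. *)
  move=> k l; case: (eqVneq i j) l => [<-|_] l; last first.
    by rewrite mxE; apply: homog0.
  by rewrite /= conform_mx_id mxE; apply: homogMn; apply: homog_var.
by move=> p q; rewrite mxE; apply: hom_block.
Qed.

Lemma homog_map_intr n p q (M : 'M[int]_(p, q)) :
  homog_mx 0 (map_mx intr M : 'M[ncseries n]_(p, q)).
Proof. by move=> i j; rewrite mxE; apply: homog_intr. Qed.

Theorem proposition1p2 (f : ncseries 2) (hf : rational_star f)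
    (n : nat) (hn : (1 <= n)%N) (d : 'I_n -> nat)
    (A : 'M[int]_(\sum_i d i)) (hA : seifert A)
    (e : forall i : 'I_n, {set 'I_(d i)}) (he : half_sets e) :
  rational (chi f A e).
Proof.
apply: rational_mx_tr; apply: rational_mxB; apply: rational_star_eval => //;
  by [apply: homog_diag_x | apply: homog_map_intr].
Qed.
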